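(* Let $\mathbb{F}$ be a field and $n\ge 1$. For a matrix $M\in\mathbb{F}^{n\times n}$ let $\mathcal{E}(M)$ be the $n$-dimensional evolution algebra over $\mathbb{F}$ with structure matrix $M$. Let $I_n$ be the $n\times n$ identity matrix and let $K_n$ be the $n\times n$ matrix with all diagonal entries $0$ and all off-diagonal entries $1$. The following is a complete list, without repetition up to isomorphism, of the $n$-dimensional idempotent evolution algebras over $\mathbb{F}$ whose automorphism group is isomorphic to the symmetric group $S_n$ (that is, each listed algebra is idempotent with automorphism group isomorphic to $S_n$, distinct listed algebras are non-isomorphic, and every $n$-dimensional idempotent evolution algebra over $\mathbb{F}$ with automorphism group isomorphic to $S_n$ is isomorphic to a listed one). \begin{enumerate} \item For $n=1$: only $\mathcal{E}(M)$ with $M=(1)$. \item For $n=2$: $\mathcal{E}\begin{pmatrix}1&c\\c&1\end{pmatrix}$ for each $c\in\mathbb{F}$ with $c^2\ne1$; and $\mathcal{E}\begin{pmatrix}0&1\\1&0\end{pmatrix}$, the latter only if $x^3-1$ has exactly one root in $\mathbb{F}$. \item For $n=3$: $\mathcal{E}\begin{pmatrix}1&c&c\\c&1&c\\c&c&1\end{pmatrix}$ for each $c\in\mathbb{F}$ with $c\ne1$ and, if $\mathrm{char}(\mathbb{F})\neq 2$, also $c\ne-1/2$; $\mathcal{E}\begin{pmatrix}0&1&0\\1&0&0\\0&0&1\end{pmatrix}$, only if $x^3-1$ has $3$ distinct roots in $\mathbb{F}$; and $\mathcal{E}\begin{pmatrix}0&1&1\\1&0&1\\1&1&0\end{pmatrix}$,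 only if $\mathrm{char}(\mathbb{F})\ne2$. \item For $n\ge4$: $\mathcal{E}(I_n+cK_n)$ (all diagonal entries $1$, all off-diagonal entries $c$) for each $c\in\mathbb{F}$ with $c\ne1$ and, if $\mathrm{char}(\mathbb{F})\nmid n-1$, also $c\ne 1/(1-n)$; and $\mathcal{E}(K_n)$, only if $\mathrm{char}(\mathbb{F})\nmid n-1$. \end{enumerate}
   Context: An $n$-dimensional evolution algebra over a field $\mathbb{F}$ is a (not necessarily associative) commutative $\mathbb{F}$-algebra $\mathcal{E}$ that has a vector space basis $e_1,\dots,e_n$ (called a natural basis) with $e_ie_j=0$ for all $i\ne j$. The structure matrix of $\mathcal{E}$ with respect to this natural basis is the $n\times n$ matrix $A=(a_{ij})$ over $\mathbb{F}$ determined by $e_i^2=\sum_{j=1}^n a_{ji}e_j$ for $1\le i\le n$. The algebra $\mathcal{E}$ is called idempotent if $\mathcal{E}^2=\mathcal{E}$, where $\mathcal{E}^2$ is the linear span of all products; equivalently, $A$ is nonsingular. Automorphisms and isomorphisms are those of $\mathbb{F}$-algebras. The condition $\mathrm{char}(\mathbb{F})\nmid n-1$ means that $n-1\neq 0$ in $\mathbb{F}$ (so it holds in characteristic $0$ for $n\ge2$). *)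

(* Defs.v *)
From HB Require Import structures.
From mathcomp Require Import all_boot all_fingroup all_algebra.
Set Implicit Arguments.
Unset Strict Implicit.
Unset Printing Implicit Defensive.

Import GRing.Theory.
Local Open Scope ring_scope.

(* MathComp's algType is associative and unital, hence a separate record. *)
Record comAlgebra (F : fieldType) := ComAlgebra {
  carrier :> vectType F;
  amul : {bilinear carrier -> carrier -> carrier};
  amulC : commutative amul }.

Section Algebras.
Variable F : fieldType.
Implicit Types A B : comAlgebra F.

Definition natural_basis n A (e : n.-tuple A) : Prop :=
  basis_of fullv e /\ forall i j : 'I_n, i != j -> amul A e`_i e`_j = 0.

Definition evolution_algebra n A : Prop :=
  exists e : n.-tuple A, natural_basis e.

(* The i-th square is read off column i of M. *)
Definition structure_matrix n A (e : n.-tuple A) (M : 'M[F]_n) : Prop :=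
  forall i : 'I_n, amul A e`_i e`_i = \sum_j M j i *: e`_j.

(* A^2 = A, where A^2 is the linear span of all products *)
Definition idempotent_algebra A : Prop :=
  forall v : A, exists s : seq (A * A), v \in <<[seq amul A p.1 p.2 | p <- s]>>%VS.

Definition algebra_iso A B (f : 'Hom(A, B)) : Prop :=
  bijective f /\ {morph f : x y / amul A x y >-> amul B x y}.

Definition isomorphic A B : Prop := exists f : 'Hom(A, B), algebra_iso f.

Definition automorphism A (f : 'End(A)) : Prop := algebra_iso f.

(* Aut(A), under composition, is isomorphic as a group to gT. *)
Definition Aut_isog A (gT : finGroupType) : Prop :=
  exists phi : gT -> 'End(A),
    [/\ injective phi,
        forall f, automorphism f <-> exists g, phi g = f
      & forall g h, phi (g * h)%g = (phi g \o phi h)%VF].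

Definition evol_mul n (M : 'M[F]_n) (u v : 'cV[F]_n) : 'cV[F]_n :=
  M *m \col_i (u i 0 * v i 0).

Fact evol_mul_bilinear n (M : 'M[F]_n) :
  bilinear_for *:%R *:%R (evol_mul M).
Proof.
by split=> [v a u1 u2|u a v1 v2]; rewrite /evol_mul /= scalemxAr -mulmxDr;
   congr (_ *m _); apply/colP=> i; rewrite !mxE ?mulrDl ?mulrDr ?mulrA // [u i 0 * a]mulrC.
Qed.

HB.instance Definition _ n (M : 'M[F]_n) :=
  bilinear_isBilinear.Build F 'cV[F]_n 'cV[F]_n 'cV[F]_n *:%R *:%R
    (evol_mul M) (evol_mul_bilinear M).

Fact evol_mulC n (M : 'M[F]_n) : commutative (evol_mul M).
Proof.
by move=> u v; congr (_ *m _); apply/colP=> i; rewrite !mxE mulrC.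
Qed.

Definition evolAlg n (M : 'M[F]_n) : comAlgebra F :=
  @ComAlgebra F 'cV[F]_n (evol_mul M) (@evol_mulC n M).

Definition std_basis n (M : 'M[F]_n) : n.-tuple (evolAlg M) :=
  [tuple (delta_mx i 0 : 'cV[F]_n) | i < n].

Lemma std_basisE n (M : 'M[F]_n) (i : 'I_n) :
  (std_basis M)`_i = delta_mx i 0 :> 'cV[F]_n.
Proof. by rewrite -tnth_nth tnth_mktuple. Qed.

Lemma col_sum_delta n (v : 'cV[F]_n) : v = \sum_i v i 0 *: delta_mx i 0.
Proof.
by rewrite {1}[v]matrix_sum_delta; apply: eq_bigr => i _; rewrite big_ord1.
Qed.

Lemma std_basis_natural n (M : 'M[F]_n) : natural_basis (std_basis M).
Proof.
split=> [|i j neq_ij]; last first.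
  rewrite !std_basisE -[RHS](mulmx0 _ M); congr (M *m _).
  apply/colP=> l; rewrite !mxE !andbT; have [->|] := eqVneq l i.
    by rewrite (negPf neq_ij) mulr0.
  by rewrite mul0r.
rewrite basisEdim size_tuple dimvf /dim /= muln1 leqnn andbT.
apply/subvP=> v _; rewrite (col_sum_delta v).
apply: memv_suml => i _; apply/(@memvZ F (evolAlg M))/memv_span.
by rewrite -(std_basisE M) mem_nth ?size_tuple.
Qed.

Lemma std_basis_matrix n (M : 'M[F]_n) : structure_matrix (std_basis M) M.
Proof.
move=> i; under eq_bigr do rewrite std_basisE.
transitivity (col i M); last first.
  by rewrite [LHS]col_sum_delta; apply: eq_bigr => j _; rewrite mxE.
rewrite !std_basisE colE; congr (M *m _); apply/colP=> l; rewrite !mxE andbT.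
by case: (l == i); rewrite ?mulr1 ?mulr0.
Qed.

Definition seqs_mx n (rows : seq (seq F)) : 'M[F]_n :=
  \matrix_(i, j) (nth [::] rows i)`_j.

Definition offdiag_mx n : 'M[F]_n := \matrix_(i, j) (i != j)%:R.

Definition Sn_evolution_algebra n A : Prop :=
  [/\ evolution_algebra n A, idempotent_algebra A & Aut_isog A 'S_n].

(* The algebras evolAlg M, for M in the list, represent each isomorphism class
   exactly once. *)
Definition complete_list n (listed : 'M[F]_n -> Prop) : Prop :=
  [/\ forall M, listed M -> Sn_evolution_algebra n (evolAlg M),
      forall M N, listed M -> listed N ->
        isomorphic (evolAlg M) (evolAlg N) -> M = N
    & forall A, Sn_evolution_algebra n A ->
        exists2 M, listed M & isomorphic A (evolAlg M)].

End Algebras.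

Arguments seqs_mx {F} n rows.
Arguments offdiag_mx F n : clear implicits.
Arguments complete_list F n listed : clear implicits.

(* Main.v *)
From HB Require Import structures.
Require Import Defs.
From mathcomp Require Import all_boot all_fingroup all_algebra.
From mathcomp Require Import ring cyclic.
Import GRing.Theory.
Local Open Scope ring_scope.

Set Implicit Arguments.
Unset Strict Implicit.
Unset Printing Implicit Defensive.

(* The natural basis of an idempotent evolution algebra is unique up to order
   and scaling, so an isomorphism E(M) -> E(N) is e_i |-> x_i e_(s i), with
   M_ji x_j = x_i^2 N_(s j)(s i). If Aut E(M) is S_n, the permutation parts of
   the automorphisms form an (anti-)endomorphism of S_n. Its kernel consists of
   diagonal automorphisms; these satisfy x_j = x_i^2 when M_ji != 0, so none is
   an involution. A normal subgroup of S_n without involution is trivial, unless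
   n = 3.
   If the kernel is trivial, the scalars x form a cocycle. The stabiliser of i
   acts trivially on e_i, so the orbit of a multiple of e_i is a natural basis
   permuted by S_n, in which the structure matrix is a I_n + b K_n.
   If n = 3 and the kernel is not trivial, a diagonal automorphism with
   entries w, w^2, 1, where w^3 = 1 != w, forces the exceptional matrix. Its
   automorphisms are the permutations of the idempotents (w^k, w^2k, 1). *)

(** * Endomorphisms of the column space as square matrices *)

Section ColHom.
Variables (F : fieldType) (n : nat).
Implicit Types P Q : 'M[F]_n.

Definition colhom P : 'End('cV[F]_n) := linfun (mulmx P).

Lemma colhomE P v : colhom P v = P *m v.
Proof. by rewrite lfunE. Qed.

Lemma colhom_surj (f : 'End('cV[F]_n)) : exists P, f = colhom P.
Proof.
exists (\matrix_(i, j) f (delta_mx j 0) i 0); apply/lfunP => v.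
rewrite colhomE [in LHS](col_sum_delta v) linear_sum.
apply/colP => i; rewrite summxE !mxE; apply: eq_bigr => j _.
by rewrite linearZ !mxE mulrC.
Qed.

Lemma mulmx_col_inj P Q : (forall v : 'cV_n, P *m v = Q *m v) -> P = Q.
Proof.
by move=> eqPQ; apply/matrixP => i j; have:= eqPQ (delta_mx j 0);
   rewrite -!colE => /colP/(_ i); rewrite !mxE.
Qed.

Lemma colhom_inj : injective colhom.
Proof.
move=> P Q eqPQ; apply: mulmx_col_inj => v.
by rewrite -!colhomE eqPQ.
Qed.

Lemma colhomM P Q : (colhom P \o colhom Q)%VF = colhom (P *m Q).
Proof. by apply/lfunP => v; rewrite comp_lfunE !colhomE mulmxA. Qed.

Lemma colhom_bij P : P \in unitmx -> bijective (colhom P).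
Proof.
by move=> uP; exists (colhom (invmx P)) => v; rewrite !colhomE ?mulKmx ?mulKVmx.
Qed.

(** The preimages of the unit vectors, taken as columns, form a right inverse of [P]. *)
Lemma colhom_unit P : bijective (colhom P) -> P \in unitmx.
Proof.
case=> g _ fK; have := @mulmx1_unit _ _ P (\matrix_(i, j) g (delta_mx j 0) i 0).
case=> //; apply: mulmx_col_inj => v;
  rewrite mul1mx [v]col_sum_delta mulmx_sumr.
apply: eq_bigr => i _; rewrite -scalemxAr; congr (_ *: _).
rewrite -mulmxA -colE -[RHS]fK colhomE; congr (_ *m _).
by apply/colP => j; rewrite !mxE.
Qed.

Lemma unitmx_mul_neq0 P (v : 'cV_n) : P \in unitmx -> P *m v = 0 -> v = 0.
Proof. by move=> uP Pv0; rewrite -(mulKmx uP v) Pv0 mulmx0. Qed.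

Lemma unitmx_col_neq0 P j : P \in unitmx -> exists i, P i j != 0.
Proof.
move=> uP; apply/existsP; apply: contraT => /existsPn P0; exfalso.
have: (delta_mx j 0 : 'cV[F]_n) = 0.
  apply: unitmx_mul_neq0 uP _; rewrite -colE; apply/colP => i; rewrite !mxE.
  by apply/eqP; move: (P0 i); rewrite negbK.
by move/colP/(_ j); rewrite !mxE !eqxx => /eqP; rewrite oner_eq0.
Qed.

Lemma unitmx_row_neq0 P i : P \in unitmx -> exists j, P i j != 0.
Proof.
rewrite -unitmx_tr => /unitmx_col_neq0-/(_ i)[j]; rewrite mxE => Pij.
by exists j.
Qed.

End ColHom.

(** * Monomial matrices and isomorphisms of evolution algebras *)

Section Monomial.
Variables (F : fieldType) (n : nat).
Implicit Types (M N P : 'M[F]_n) (s t : 'S_n) (x y : 'I_n -> F).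

Definition mono_mx s x : 'M[F]_n := \matrix_(k, i) (x i *+ (k == s i)).

(** Permutations compose from left to right, matrices from right to left; hence the order
    [t * s]. *)
Lemma mono_mxM s t x y :
  mono_mx s x *m mono_mx t y = mono_mx (t * s) (fun i => y i * x (t i)).
Proof.
apply/matrixP => k i; rewrite !mxE (bigD1 (t i)) //= big1 => [|l lt].
  rewrite !mxE eqxx addr0 permM mulr1n.
  by case: (k == _); rewrite ?mul0r // !mulr1n mulrC.
by rewrite !mxE (negPf lt) mulr0.
Qed.

Lemma mono_mx1 : mono_mx 1 (fun=> 1) = 1%:M.
Proof. by apply/matrixP => i j; rewrite !mxE perm1. Qed.

Lemma eq_mono_mx s x y : x =1 y -> mono_mx s x = mono_mx s y.
Proof. by move=> eqxy; apply/matrixP => k i; rewrite !mxE eqxy. Qed.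

Lemma mono_mx_inj s t x y : (forall i, x i != 0) ->
  mono_mx s x = mono_mx t y -> s = t /\ x =1 y.
Proof.
move=> x0 /matrixP eqst.
have eq_s : s = t.
  apply/permP => i; have := eqst (s i) i; rewrite !mxE eqxx.
  by case: eqP => // _ /eqP; rewrite (negPf (x0 i)).
by split=> // i; have := eqst (s i) i; rewrite !mxE eq_s eqxx.
Qed.

Lemma mono_mx_unit s x : (forall i, x i != 0) -> mono_mx s x \in unitmx.
Proof.
move=> x0; case: (@mulmx1_unit _ _ (mono_mx s x)
  (mono_mx s^-1 (fun i => (x (s^-1 i)%g)^-1))) => //.
rewrite mono_mxM mulVg -mono_mx1; apply: eq_mono_mx => i.
by rewrite mulVf.
Qed.

Lemma mono_mx_act s x (v : 'cV_n) i : (mono_mx s x *m v) (s i) 0 = x i * v i 0.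
Proof.
rewrite mxE (bigD1 i) //= big1 ?addr0 => [|j ji]; first by rewrite mxE eqxx.
by rewrite mxE (inj_eq perm_inj) eq_sym (negPf ji) mul0r.
Qed.

(** For f : e_i |-> x_i e_(s i), this compares the coefficients of e_(s j) in f(e_i^2) and in
    f(e_i)^2. *)
Definition mono_rel M N s x : Prop :=
  (forall i, x i != 0) /\ forall i j, M j i * x j = x i ^+ 2 * N (s j) (s i).

Lemma evol_mulE M (u v : 'cV[F]_n) j :
  evol_mul M u v j 0 = \sum_i M j i * (u i 0 * v i 0).
Proof. by rewrite mxE; apply: eq_bigr => i _; rewrite mxE. Qed.

Lemma mono_iso M N s x : mono_rel M N s x ->
  @algebra_iso F (evolAlg M) (evolAlg N) (colhom (mono_mx s x)).
Proof.
case=> x0 MN; split; first exact/colhom_bij/mono_mx_unit.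
move=> u v; rewrite !colhomE; apply/colP => k /=.
rewrite -(permKV s k) mono_mx_act !evol_mulE.
rewrite [RHS](reindex_inj (@perm_inj _ s)) mulr_sumr; apply: eq_bigr => i _.
rewrite !mono_mx_act mulrA [x _ * _]mulrC MN.
by ring.
Qed.

(** Since f(e_i) f(e_j) = 0 and [N] is invertible, distinct columns of the matrix of f have disjoint
    supports. No column is zero, so each has room for exactly one nonzero entry. *)
Lemma iso_mono M N (f : 'Hom(evolAlg M, evolAlg N)) :
  N \in unitmx -> algebra_iso f ->
  exists s x, mono_rel M N s x /\ f = colhom (mono_mx s x).
Proof.
move=> uN [bij_f]; have [P fP] := colhom_surj f.
rewrite {}fP in bij_f * => fM; have uP := colhom_unit bij_f.
have orthP i j k : i != j -> P k i * P k j = 0.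
  move=> neq_ij; have := fM (delta_mx i 0) (delta_mx j 0).
  have -> : amul (evolAlg M) (delta_mx i 0 : 'cV_n) (delta_mx j 0) = 0.
    have := (std_basis_natural M).2 i j neq_ij.
    by rewrite !std_basisE.
  rewrite linear0 !colhomE -!colE => /esym/(unitmx_mul_neq0 uN)/colP/(_ k).
  by rewrite !mxE.
have [s Ps] := fin_all_exists (fun i => unitmx_col_neq0 i uP).
have inj_s : injective s.
  move=> i j eq_s; apply: contraTeq isT => /orthP-/(_ (s i))/eqP.
  by rewrite mulf_eq0 (negPf (Ps i)) eq_s (negPf (Ps j)).
have eqP : P = mono_mx (perm inj_s) (fun i => P (s i) i).
  apply/matrixP => k i; rewrite mxE permE; case: eqP => [-> //|ki].
  have /codomP[j def_k] := injF_onto inj_s k.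
  have ji : j != i by apply/eqP => eq_ji; rewrite def_k eq_ji in ki.
  have /eqP := orthP _ _ k ji; rewrite mulf_eq0 {1}def_k (negPf (Ps j)).
  by move/eqP.
exists (perm inj_s), (fun i => P (s i) i); split; last by rewrite -eqP.
split=> // i j; have := fM (delta_mx i 0) (delta_mx i 0).
move/colP => /(_ (perm inj_s j)); rewrite !colhomE {1}eqP mono_mx_act /=.
rewrite !evol_mulE (bigD1 i) //= big1 => [|l li].
  rewrite !mxE !eqxx !mulr1 addr0 mulrC => ->.
  rewrite (bigD1 (s i)) //= big1 => [|l li]; rewrite -!colE !mxE.
    by rewrite addr0 mulrC expr2 (permE inj_s i).
  have -> : P l i = 0 by rewrite {1}eqP mxE permE (negPf li).
  by rewrite mul0r mulr0.
by rewrite !mxE (negPf li) mul0r mulr0.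
Qed.

End Monomial.

(** * Invariance under isomorphism and reduction to matrices *)

Section Transport.
Variable F : fieldType.
Implicit Types A B C : comAlgebra F.

Lemma bij_lfunK (A B : vectType F) (f : 'Hom(A, B)) :
  bijective f -> cancel f f^-1%VF /\ cancel f^-1%VF f.
Proof.
move=> bij_f; have fK : cancel f f^-1%VF by apply/lker0_lfunK/lker0P/bij_inj.
by split=> //; apply/(bij_can_sym bij_f).
Qed.

Lemma algebra_iso_comp A B C (f : 'Hom(A, B)) (g : 'Hom(B, C)) :
  algebra_iso f -> algebra_iso g -> algebra_iso (g \o f)%VF.
Proof.
move=> [bij_f fM] [bij_g gM]; split=> [|x y]; last by rewrite !lfunE /= fM gM.
by apply: (eq_bij (bij_comp bij_g bij_f)) => x; rewrite lfunE.
Qed.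

Lemma algebra_iso_inv A B (f : 'Hom(A, B)) :
  algebra_iso f -> algebra_iso f^-1%VF.
Proof.
case=> bij_f fM; have [fK fVK] := bij_lfunK bij_f; split=> [|x y].
  by exists f.
by rewrite -{1}(fVK x) -{1}(fVK y) -fM fK.
Qed.

Lemma isomorphic_sym A B : isomorphic A B -> isomorphic B A.
Proof. by case=> f iso_f; exists f^-1%VF; apply: algebra_iso_inv. Qed.

Lemma isomorphic_trans A B C :
  isomorphic A B -> isomorphic B C -> isomorphic A C.
Proof.
by move=> [f isof] [g isog]; exists (g \o f)%VF; apply: algebra_iso_comp.
Qed.

Lemma isomorphic_idempotent A B :
  isomorphic A B -> idempotent_algebra A -> idempotent_algebra B.
Proof.
move=> [f [bij_f fM]] idA v; have [fK fVK] := bij_lfunK bij_f.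
have [s s_v] := idA (f^-1%VF v); exists [seq (f p.1, f p.2) | p <- s].
have := memv_img f s_v; rewrite fVK limg_span -!map_comp.
by under eq_map => p do rewrite /= fM.
Qed.

Lemma isomorphic_Aut_isog A B (gT : finGroupType) :
  isomorphic A B -> Aut_isog A gT -> Aut_isog B gT.
Proof.
move=> [f iso_f] [phi [phi_inj phi_aut phiM]].
have [fK fVK] := bij_lfunK iso_f.1; have iso_fV := algebra_iso_inv iso_f.
exists (fun g => (f \o (phi g \o f^-1))%VF); split.
- move=> g h /lfunP eq_gh; apply/phi_inj/lfunP => x; apply: (can_inj fK).
  by have := eq_gh (f x); rewrite !comp_lfunE fK.
- move=> h; split=> [aut_h | [g <-]]; last first.
    apply/algebra_iso_comp/iso_f/algebra_iso_comp => //.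
    by apply/phi_aut; exists g.
  have /phi_aut[g phi_g] : automorphism (f^-1 \o (h \o f))%VF.
    exact/algebra_iso_comp/iso_fV/algebra_iso_comp.
  exists g; apply/lfunP => x.
  by rewrite phi_g !comp_lfunE !fVK.
- move=> g h; apply/lfunP => x; rewrite phiM.
  by rewrite !comp_lfunE fK.
Qed.

(** Every product lies in the image of [M]; conversely, [M *m w] is the combination of the squares
    e_i^2 with coefficients w_i. *)
Lemma evolAlg_idempotent n (M : 'M[F]_n) :
  idempotent_algebra (evolAlg M) <-> M \in unitmx.
Proof.
split=> [idM | uM v].
  suff /fin_all_exists[w Mw] : forall i, exists w :
    'cV_n, M *m w = delta_mx i 0.
    case: (@mulmx1_unit _ _ M (\matrix_(i, j) w j i 0)) => //.
    apply: mulmx_col_inj => v; rewrite mul1mx [v]col_sum_delta mulmx_sumr.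
    apply: eq_bigr => i _; rewrite -scalemxAr; congr (_ *: _).
    rewrite -mulmxA -colE -[RHS]Mw; congr (_ *m _).
    by apply/colP => j; rewrite !mxE.
  move=> i; have [s s_v] := idM (delta_mx i 0 : 'cV_n).
  suff : (delta_mx i 0 : 'cV_n) \in limg (colhom M).
    by case/memv_imgP => w _ ->; exists w; rewrite colhomE.
  apply: subvP s_v; apply/span_subvP => _ /mapP[p _ ->].
  by rewrite -[amul _ _ _](colhomE M) memv_img ?memvf.
pose w := invmx M *m v.
exists [seq (delta_mx i 0 : 'cV_n, delta_mx i 0 : 'cV_n) | i : 'I_n].
have -> : v = M *m w by rewrite mulKVmx.
rewrite [w]col_sum_delta mulmx_sumr; apply: memv_suml => i _.
rewrite -scalemxAr; apply: memvZ; apply: memv_span; rewrite -map_comp.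
apply/mapP; exists i; first by rewrite mem_enum.
congr (M *m _); apply/colP => j; rewrite !mxE andbT.
by case: (j == i); rewrite ?mulr1 ?mulr0.
Qed.

(** The coordinate map of a natural basis is the isomorphism. *)
Lemma evolution_algebraE n A :
  evolution_algebra n A -> exists M : 'M[F]_n, isomorphic A (evolAlg M).
Proof.
case=> e [e_basis e_orth].
have free_e := basis_free e_basis.
have coord_e v : v = \sum_i coord e i v *: e`_i.
  by apply: coord_basis e_basis _; rewrite memvf.
pose M : 'M[F]_n := \matrix_(j, i) coord e j (amul A e`_i e`_i).
exists M; pose f (v : A) : 'cV[F]_n := \col_i coord e i v.
have f_linear : linear f.
  by move=> a u v; apply/colP => i; rewrite !mxE linearP.
pose fL := GRing.isLinear.Build F A _ _ f f_linear.
pose fl : {linear A -> 'cV[F]_n} := HB.pack f fL.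
exists (linfun fl); split.
  exists (fun w : 'cV_n => \sum_i w i 0 *: e`_i) => [v | w].
    by rewrite lfunE /= [RHS]coord_e; apply: eq_bigr => i _; rewrite mxE.
  by rewrite lfunE /=; apply/colP => i; rewrite mxE coord_sum_free.
move=> u v; rewrite !lfunE /=; apply/colP => j; rewrite evol_mulE mxE.
rewrite {1}(coord_e u) linear_sumlz linear_sum; apply: eq_bigr => i _.
rewrite linearZl_LR linearZ /= {1}(coord_e v) linear_sumr linear_sum.
rewrite (bigD1 i) //= big1 => [|l li]; last first.
  by rewrite linearZr_LR /= e_orth 1?eq_sym // scaler0 linear0.
by rewrite !mxE addr0 !linearZ /= mulrA mulrC.
Qed.

End Transport.

(** * Normal subgroups of the symmetric group *)

Section PermGroups.
Variable T : finType.
Implicit Types (i j : T) (s : {perm T}) (K : {group {perm T}}).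

Lemma perm_2transitive i j i' j' : i != j -> i' != j' ->
  exists s, s i = i' /\ s j = j'.
Proof.
(* The second transposition moves the image of [j] to [j'] and fixes [i']. *)
move=> neq_ij neq_ij'; exists (tperm i i' * tperm (tperm i i' j) j')%g.
rewrite !permM tpermL tpermL; split=> //; apply: tpermD; last by rewrite eq_sym.
by rewrite -{2}(tpermL i i') (inj_eq perm_inj) eq_sym.
Qed.

(** No element of [K] can map a pair to a disjoint pair, as a commutator would then be an
    involution. A nontrivial element with this property is a transposition or a 3-cycle, and a
    3-cycle times a suitable conjugate does move some pair off itself. *)
Lemma normal_without_involution K : (3 < #|T|)%N ->
    (K <| [set: {perm T}])%g -> {in K, forall g, (g * g = 1 -> g = 1)%g} ->
  K :=: 1%g.
Proof.
move=> T4 /andP[_ nK] noinv.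
have KJ g s : g \in K -> (g ^ s)%g \in K.
  by move=> Kg; rewrite memJ_norm // (subsetP nK) ?inE.
(* [g, (a c)] would be a product of two disjoint transpositions. *)
have meet g a c : g \in K -> a != c ->
    g a \notin [:: a; c] -> g c \notin [:: a; c] -> False.
  rewrite !inE !negb_or => Kg neq_ac /andP[gaa gac] /andP[gca gcc].
  pose t := tperm a c; pose t' := tperm (g a) (g c).
  have tt' : (t * t' = t' * t)%g.
    by rewrite [RHS]conjgC tpermJ !tpermD // eq_sym.
  have Kh : (t' * t)%g \in K.
    rewrite /t' -tpermJ -/t (_ : _ * _ = g^-1 * g ^ t)%g; last first.
      by rewrite !conjgE tpermV !mulgA.
    by rewrite groupM ?groupV ?KJ.
  have /permP/(_ a) : (t' * t = 1)%g.
    apply: noinv Kh _; rewrite -{2}tt' mulgA -(mulgA t') tperm2 mulg1.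
    by rewrite tperm2.
  by rewrite permM perm1 /t' tpermD // /t tpermL => eq_ca;
    rewrite eq_ca eqxx in neq_ac.
apply/trivgP/subsetP => g Kg; rewrite inE; apply: contraT => g1.
have [a ga] : exists a, g a != a.
  apply/existsP; apply: contraR g1; rewrite negb_exists => /forallP g_id.
  by apply/eqP/permP => a; rewrite perm1; apply/eqP; move: (g_id a);
    rewrite negbK.
set b := g a in ga.
(* The pair {b, g c} has to meet {a, c}, and b is neither a nor c. *)
have gab c : c != a -> c != b -> g c = a \/ g c = c.
  move=> ca cb; have [->|gca] := eqVneq (g c) a; first by left.
  have [->|gcc] := eqVneq (g c) c; first by right.
  case: (meet g a c Kg); first by rewrite eq_sym.
    by rewrite -/b !inE negb_or ga eq_sym.
  by rewrite !inE negb_or gca.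
(* Of two points outside {a, b}, at most one is sent to a. *)
have [c [ca cb gc]] : exists c, [/\ c != a, c != b & g c = c].
  have : (1 < #|[predC [:: a; b]]|)%N.
    rewrite -(leq_add2l #|[:: a; b]|) cardC addn2 (leq_ltn_trans _ T4) //.
    by rewrite !ltnS card_size.
  case/card_gt1P => c [c' [/=]]; rewrite !inE !negb_or.
  move=> /andP[ca cb] /andP[c'a c'b] cc'.
  have [ga' | ?] := gab c ca cb; last by exists c.
  have [ga'' | ?] := gab c' c'a c'b; last by exists c'.
  by rewrite -(inj_eq (@perm_inj _ g)) ga' ga'' eqxx in cc'.
have gb : g b != b by rewrite /b (inj_eq perm_inj).
have bc : g b != c by rewrite -gc (inj_eq perm_inj) eq_sym.
(* If g b = a, then g is the transposition of a and b. *)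
have [gba | gba] := eqVneq (g b) a.
  rewrite (noinv g Kg) ?eqxx // in g1; apply/permP => d; rewrite permM perm1.
  have [->|da] := eqVneq d a; first by rewrite -/b gba.
  have [->|db] := eqVneq d b; first by rewrite gba.
  have [gd | gd] := gab d da db; last by rewrite !gd.
  by rewrite -gba in gd; move/perm_inj: gd db => ->; rewrite eqxx.
have gd : g (g b) = a.
  by case: (gab (g b)) => // /perm_inj eq_gb; rewrite eq_gb eqxx in gb.
(* Now g permutes a, b, g b cyclically and fixes c. Its conjugate sends b to c and fixes g b, so the
   product takes {a, b} to {c, g b}. *)
have gJb : (g ^ tperm c (g b))%g b = c.
  by have := permJ g (tperm c (g b)) b; rewrite tpermR tpermD // eq_sym.
have gJc : (g ^ tperm c (g b))%g (g b) = g b.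
  by have := permJ g (tperm c (g b)) c; rewrite gc tpermL.
case: (meet (g * g ^ tperm c (g b))%g a b).
- by rewrite groupM ?KJ.
- by rewrite eq_sym.
- by rewrite permM gJb !inE negb_or ca cb.
- by rewrite permM gJc !inE negb_or gba gb.
Qed.

End PermGroups.

(** * Rescaling a natural basis that S_n permutes up to scalars *)

Section Symmetric.
Variable F : fieldType.

Section Relations.
Variable n : nat.
Implicit Types (M N P : 'M[F]_n) (s t : 'S_n) (x y : 'I_n -> F).

(* Over an invertible M this says that the only automorphism of evolAlg M that
   is diagonal in the natural basis is the identity. *)
Definition rigid M : Prop := forall x, (forall i, x i != 0) ->
  (forall i j, M j i != 0 -> x j = x i ^+ 2) -> forall i, x i = 1.

Lemma mono_rel_neq0 M N s x i j :
  mono_rel M N s x -> (N (s j) (s i) == 0) = (M j i == 0).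
Proof.
case=> x0 MN; have /eqP := MN i j.
case: (eqVneq (M j i) 0) => [-> | Mji].
  by rewrite mul0r eq_sym mulf_eq0 expf_eq0 (negPf (x0 i)).
by apply: contraTF => /eqP->; rewrite mulr0 mulf_neq0.
Qed.

Lemma mono_rel_comp M N P s t x y : mono_rel M N s x -> mono_rel N P t y ->
  mono_rel M P (s * t) (fun i => x i * y (s i)).
Proof.
move=> [x0 MN] [y0 NP]; split=> [i | i j]; first by rewrite mulf_neq0.
by rewrite !permM mulrA MN -mulrA NP; ring.
Qed.

(** The quotient of the two scalings is that of a diagonal automorphism of [M], which rigidity makes
    trivial. *)
Lemma mono_rel_uniq M N s x y :
  rigid M -> mono_rel M N s x -> mono_rel M N s y -> x =1 y.
Proof.
move=> rM [x0 Mx] [y0 My] i; apply: (mulIf (invr_neq0 (y0 i))).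
rewrite divff //; apply: (rM (fun i => x i / y i)) => {}i;
  first by rewrite mulf_neq0 ?invr_neq0.
move=> j Mji; apply: (mulfI Mji).
have Nji : N (s j) (s i) != 0.
  by apply: contraNneq Mji => N0;
    rewrite -(mulIr_eq0 _ (mulIf (x0 j))) Mx N0 mulr0.
have eqM : M j i = y i ^+ 2 * N (s j) (s i) / y j by rewrite -My mulfK.
rewrite mulrA Mx eqM; field; rewrite y0 y0 //.
Qed.

Lemma mono_rel1 M N x : mono_rel M N 1 x <->
  (forall i, x i != 0) /\ forall i j, N j i = M j i * x j / x i ^+ 2.
Proof.
by split=> -[x0 MN]; split=> // i j; have := MN i j; rewrite !perm1 => eqM;
   rewrite ?eqM; field; rewrite x0.
Qed.

Lemma mono_rel_rigid M N x : mono_rel M N 1 x -> rigid M -> rigid N.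
Proof.
move=> MN rM y y0 Ny; apply: rM => // i j Mji; apply: Ny.
by have := mono_rel_neq0 i j MN; rewrite !perm1 => ->.
Qed.

Lemma mono_rel_isomorphic M N s x :
  mono_rel M N s x -> isomorphic (evolAlg M) (evolAlg N).
Proof. by move=> MN; exists (colhom (mono_mx s x)); apply: mono_iso. Qed.

Lemma isomorphic_unitmx M N :
  isomorphic (evolAlg M) (evolAlg N) -> M \in unitmx -> N \in unitmx.
Proof.
by rewrite -!evolAlg_idempotent => isoMN; apply: isomorphic_idempotent isoMN.
Qed.

Definition sym_mx (a b : F) : 'M[F]_n := a%:M + b *: offdiag_mx F n.

Lemma sym_mxE a b i j : sym_mx a b i j = if i == j then a else b.
Proof.
by rewrite !mxE; case: eqP; rewrite ?mulr0 ?mulr1 ?addr0 ?mulr1n ?mulr0n ?add0r.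
Qed.

(** By double transitivity, one off-diagonal entry determines all the others, and so does one
    diagonal entry. *)
Lemma perm_invariant_sym_mx M :
  (forall s i j, M (s i) (s j) = M i j) -> exists a b, M = sym_mx a b.
Proof.
move=> invM; case: (pickP (fun p :
  'I_n * 'I_n => p.1 != p.2)) => [[k l] /= kl | eqI].
  exists (M k k), (M k l); apply/matrixP => i j; rewrite sym_mxE.
  case: eqVneq => [-> | ij]; first by rewrite -[RHS](invM (tperm k j)) tpermL.
  by have [s [<- <-]] := perm_2transitive kl ij.
(* Without two distinct indices, n is at most 1. *)
case: (pickP 'I_n) => [k _ | no]; last first.
  by exists 0, 0; apply/matrixP => i; have := no i.
exists (M k k), 0; apply/matrixP => i j.
have all_k l : l = k by apply/eqP; have := eqI (l, k); move/negbFE.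
by rewrite sym_mxE (all_k i) (all_k j) eqxx.
Qed.

End Relations.

(** * The cocycle of scalars *)

Section Cocycle.
Variables (n : nat) (M : 'M[F]_n) (X : 'S_n -> 'I_n -> F).
Hypotheses (uM : M \in unitmx) (rM : rigid M).
Hypothesis XP : forall s, mono_rel M M s (X s).

Let X_neq0 s i : X s i != 0. Proof. exact: (XP s).1. Qed.

Let XM s t i : X (s * t) i = X s i * X t (s i).
Proof. exact: (mono_rel_uniq rM (XP _) (mono_rel_comp (XP s) (XP t))). Qed.

Let X1 i : X 1 i = 1.
Proof. by apply: (mulfI (X_neq0 1 i));
  rewrite mulr1 -{3}[1%g]mulg1 XM perm1. Qed.

(** As the transposition t fixes i, the scalar [X t i] squares to 1. A fourth index l settles the
    sign: the entry [M l i] gives [X t l = 1], and then [M i l] gives [X t i = 1]. *)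
Lemma cocycle_tperm i j k : M i i = 0 -> i != j -> i != k -> j != k ->
  X (tperm j k) i = 1.
Proof.
move=> Mii ij ik jk; pose t := tperm j k.
have diag0 l : M l l = 0.
  apply/eqP; have := mono_rel_neq0 i i (XP (tperm i l)).
  by rewrite tpermL Mii eqxx.
have off a b : a != b -> M a b != 0.
  move=> ab; have [r Mri] := unitmx_col_neq0 i uM.
  have ri : r != i by apply: contraNneq Mri => ->; rewrite Mii.
  have [s [<- <-]] := perm_2transitive ri ab.
  by rewrite (mono_rel_neq0 i r (XP s)).
have [_ Xt] := XP t.
have ti : t i = i by rewrite tpermD // eq_sym.
have Xi2 : X t i ^+ 2 = 1 by rewrite expr2 -{2}ti -XM tperm2 X1.
have [[l /and3P[li lj lk]] | no_l] :
    (exists l, [&& l != i, l != j & l != k])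
    \/ (forall l, l \notin [:: i; j; k] -> False).
- case: (pickP (fun l => [&& l != i, l != j & l != k])) => [l l_ijk | none].
    by left; exists l.
  by right=> l; rewrite !inE !negb_or none.
- have tl : t l = l by rewrite tpermD // eq_sym.
  have Xl : X t l = 1.
    by apply: (mulfI (off _ _ li)); rewrite Xt ti tl Xi2 mulrC.
  have := Xt l i; rewrite ti tl Xl expr1n mul1r -[RHS]mulr1.
  by apply: mulfI; apply: off; rewrite eq_sym.
(* With three indices and X t i = -1 the columns of M are dependent. *)
move/eqP: Xi2; rewrite sqrf_eq1 => /orP[/eqP // | /eqP Xi]; exfalso.
have tj : t j = k by rewrite tpermL.
have tk : t k = j by rewrite tpermR.
have Xjk : X t j * X t k = 1 by rewrite -tj -XM tperm2 X1.
set u := X t j in Xjk; have u0 : u != 0 by apply: X_neq0.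
have Xk : X t k = u^-1 by apply: (mulfI u0); rewrite Xjk divff.
have Mki : M k i = M j i * u.
  by have := Xt i j; rewrite ti tj Xi sqrrN expr1n mul1r.
have Mij : M i j = - (u ^+ 2 * M i k).
  by have := Xt j i; rewrite ti tj Xi mulrN1 => <-; rewrite opprK.
have Mkj : M k j = u ^+ 3 * M j k.
  have := Xt j k; rewrite tj tk Xk -/u => /(canRL (mulfVK u0))->; ring.
(* A kernel vector of [M]: rows i and k cancel by [Mij], [Mki] and [Mkj], row j by [diag0] alone. *)
pose v : 'cV[F]_n := \col_c (if c == i then - (u ^+ 2 * M j k)
  else if c == j then M j i else if c == k then M j i * u ^+ 2 else 0).
suff /colP/(_ j) : v = 0.
  rewrite !mxE eqxx eq_sym (negPf ij) => /eqP; apply/negP/off.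
  by rewrite eq_sym.
have sumE (f : 'I_n -> F) : \sum_c f c = f i + (f j + f k).
  rewrite (bigD1 i) // (bigD1 j) /= 1?eq_sym // (bigD1 k) /=; last first.
    by rewrite !(eq_sym k) ik jk.
  rewrite big1 ?addr0 // => c /andP[/andP[ci cj] ck].
  by case: (no_l c); rewrite !inE !negb_or ci cj.
apply: (unitmx_mul_neq0 uM); apply/colP => r; rewrite mxE sumE !mxE !eqxx.
rewrite !(eq_sym _ i) (negPf ij) (negPf ik) eq_sym (negPf jk).
have [->|ri] := eqVneq r i; first by rewrite diag0 Mij; ring.
have [->|rj] := eqVneq r j; first by rewrite diag0; ring.
have [->|rk] := eqVneq r k; first by rewrite diag0 Mki Mkj; ring.
by case: (no_l r); rewrite !inE !negb_or ri rj.
Qed.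

(** If M_ii is nonzero, the scalar equals its own square. Otherwise transpositions fixing i are
    split off from s, by induction on the number of moved points. *)
Lemma cocycle_stab (s : 'S_n) i : s i = i -> X s i = 1.
Proof.
move=> si; have [Mii | Mii] := eqVneq (M i i) 0; last first.
  apply: (mulfI (X_neq0 s i)); apply: (mulfI Mii).
  by have := (XP s).2 i i; rewrite si mulr1 => ->; rewrite mulrC expr2.
have [m] := ubnP #|[pred j | s j != j]|; elim: m s si => // m IHm s si le_m.
have [/existsP[j sj] | s1] := boolP [exists j, s j != j]; last first.
  rewrite (_ : s = 1%g) ?X1 //; apply/permP => j; rewrite perm1.
  by apply: contraNeq s1 => sj; apply/existsP; exists j.
have ij : i != j by apply: contraNneq sj => <-; rewrite si.
have isj : i != s j by rewrite -{1}si (inj_eq perm_inj).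
(* The product [s * t] fixes j and moves no point that s fixes. *)
pose t := tperm j (s j); have ti : t i = i by rewrite tpermD // eq_sym.
have := IHm (s * t)%g; rewrite permM si ti XM si.
rewrite cocycle_tperm ?(eq_sym j (s j)) // mulr1; apply=> //; rewrite -ltnS;
  apply: leq_trans le_m; rewrite ltnS.
apply: proper_card; apply/properP; split; last first.
  by exists j; rewrite !inE // permM tpermR eqxx.
apply/subsetP => l; rewrite !inE permM /t; apply: contra => /eqP sl.
rewrite sl tpermD //; first by apply: contraNneq sj => ->; rewrite sl.
rewrite -[X in _ != X]sl (inj_eq perm_inj).
by apply: contraNneq sj => ->; rewrite sl.
Qed.

End Cocycle.

(** The vector lam_i e_i is the image of e_0 under an automorphism taking index 0 to i; by
    [cocycle_stab] the choice of automorphism does not matter. These vectors are permuted without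
    scalars, so their structure matrix [N] is invariant under S_n. *)
Lemma symmetric_mono_rel n (M : 'M[F]_n.+1) : M \in unitmx -> rigid M ->
    (forall s : 'S_n.+1, exists x, mono_rel M M s x) ->
  exists a b x, mono_rel M (sym_mx _ a b) 1 x.
Proof.
move=> uM rM /fin_all_exists[X XP].
have XM (s t : 'S_n.+1) i : X (s * t)%g i = X s i * X t (s i).
  exact: (mono_rel_uniq rM (XP _) (mono_rel_comp (XP s) (XP t))).
have X0 (s : 'S_n.+1) i : X s i != 0 := (XP s).1 i.
have Xst := cocycle_stab uM rM XP.
pose lam (i : 'I_n.+1) := X (tperm 0 i) 0;
  have lam0 i : lam i != 0 by apply: X0.
have lamM (s : 'S_n.+1) i : lam (s i) = lam i * X s i.
  have lamV k : lam k * X (tperm 0 k) k = 1.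
    by have := XM (tperm 0 k) (tperm 0 k) 0; rewrite tperm2 tpermL Xst ?perm1.
  apply: (mulIf (X0 (tperm 0 (s i)) (s i))); rewrite lamV.
  have := Xst (tperm 0 i * s * tperm 0 (s i))%g 0.
  by rewrite !XM !permM !tpermL tpermR => /(_ erefl).
pose N : 'M[F]_n.+1 := \matrix_(j, i) (lam i ^+ 2 * M j i / lam j).
have MN : mono_rel M N 1 (fun i => (lam i)^-1).
  apply/mono_rel1; split=> [i | i j]; first by rewrite invr_neq0.
  by rewrite mxE; field; rewrite !lam0 oner_neq0.
have [|a [b defN]] := perm_invariant_sym_mx (M := N); last first.
  by exists a, b, (fun i => (lam i)^-1); rewrite -defN.
move=> s j i; rewrite !mxE !lamM.
have -> : M (s j) (s i) = M j i * X s j / X s i ^+ 2.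
  by rewrite (XP s).2; field; rewrite X0.
by field; rewrite lam0 !X0.
Qed.

(** For K_2, rigidity amounts to the condition on cube roots of unity, by [rigid_sym_mx01_2]. *)
Definition sym_listed n (M : 'M[F]_n) : Prop :=
  [/\ M \in unitmx, rigid M & (exists c, M = sym_mx n 1 c) \/ M = sym_mx n 0 1].

(** A common rescaling of the basis multiplies a and b by the same factor, so a, or b when a = 0,
    becomes 1. Invertibility excludes a = b = 0. *)
Lemma symmetric_sym_listed n (M : 'M[F]_n.+1) : M \in unitmx -> rigid M ->
    (forall s : 'S_n.+1, exists x, mono_rel M M s x) ->
  exists2 N : 'M_n.+1, sym_listed N & isomorphic (evolAlg M) (evolAlg N).
Proof.
move=> uM rM /(symmetric_mono_rel uM rM)[a [b [x MN]]].
have scale c a' b' : c != 0 -> c * a' = a -> c * b' = b ->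
    mono_rel M (sym_mx _ a' b') 1 (fun i => x i * c).
  move=> c0 defa defb; rewrite -[1%g]mulg1.
  apply: (mono_rel_comp (y := fun=> c) MN); apply/mono_rel1; split=> // i j.
  by rewrite !sym_mxE; case: ifP => _; [rewrite -defa | rewrite -defb]; field.
suff [a' [b' [[y MN'] ab]]] : exists a' b', 
    (exists y, mono_rel M (sym_mx n.+1 a' b') 1 y) /\ (a' = 1 \/ a' = 0 /\ b'
      = 1).
  have isoMN := mono_rel_isomorphic MN'.
  exists (sym_mx _ a' b') => //; split.
  - exact: (isomorphic_unitmx isoMN uM).
  - exact: (mono_rel_rigid MN' rM).
  - by case: ab => [->|[-> ->]]; [left; exists b' | right].
have [a0|a0] := eqVneq a 0; last first.
  exists 1, (b / a); split; last by left.
  by exists (fun i => x i * a); apply: scale; rewrite // ?mulr1 // mulrC divfK.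
have [b0|b0] := eqVneq b 0; last first.
  exists 0, 1; split; last by right.
  by exists (fun i => x i * b); apply: scale; rewrite ?mulr0 ?mulr1.
have uN := isomorphic_unitmx (mono_rel_isomorphic MN) uM.
have [j] := unitmx_col_neq0 0 uN.
by rewrite sym_mxE a0 b0; case: ifP; rewrite eqxx.
Qed.

End Symmetric.

(** * Automorphisms of the symmetric algebras, and the two cases for a general one *)

Section Listed.
Variables (F : fieldType) (n : nat).
Implicit Types (M N : 'M[F]_n).

Lemma sym_mx_mono_rel a b (s : 'S_n) :
  mono_rel (sym_mx n a b) (sym_mx n a b) s (fun=> 1 : F).
Proof.
split=> [i | i j]; first exact: oner_neq0.
by rewrite mulr1 expr1n mul1r !sym_mxE (inj_eq perm_inj).
Qed.

Lemma sym_listedE M : sym_listed M -> exists a b, M = sym_mx n a b.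
Proof. by case=> _ _ [[c ->] | ->]; [exists 1, c | exists 0, 1]. Qed.

(** By rigidity the automorphisms are exactly the permutation matrices. The inverse of [g] makes up
    for the reversed order in [mono_mxM]. *)
Lemma sym_listed_Sn M : sym_listed M -> Sn_evolution_algebra n (evolAlg M).
Proof.
move=> listM; have [a [b defM]] := sym_listedE listM; case: listM => uM rM _.
split; first by exists (std_basis M); apply: std_basis_natural.
  exact/evolAlg_idempotent.
have id0 (i : 'I_n) : (fun=> 1 : F) i != 0 by apply: oner_neq0.
exists (fun g => colhom (mono_mx g^-1 (fun=> 1))); split.
- by move=> g h /colhom_inj/(mono_mx_inj id0)[/invg_inj].
- move=> f; split=> [/(iso_mono uM)[s [x [MM ->]]] | [g <-]].
    exists s^-1%g; rewrite invgK; congr colhom; apply: eq_mono_mx => i.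
    have MM1 : mono_rel M M s (fun=> 1) by rewrite defM; apply: sym_mx_mono_rel.
    by rewrite (mono_rel_uniq rM MM MM1).
  by apply: mono_iso; rewrite defM; apply: sym_mx_mono_rel.
- move=> g h; rewrite colhomM mono_mxM invMg.
  by congr colhom; apply: eq_mono_mx => i; rewrite mulr1.
Qed.

(** A diagonal of ones cannot be matched with a diagonal of zeros, and two diagonals of ones force
    all scalars to be 1. *)
Lemma sym_listed_uniq M N : (0 < n)%N -> sym_listed M -> sym_listed N ->
  isomorphic (evolAlg M) (evolAlg N) -> M = N.
Proof.
move=> n0 [_ _ cM] [uN _ cN] [f /(iso_mono uN)[s [x [MN _]]]].
pose i0 := Ordinal n0.
case: cM cN MN => [[c ->] | ->] [[d ->] | ->] // [x0 MN].
- have x1 i : x i = 1.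
    have := MN i i; rewrite !sym_mxE !eqxx mul1r mulr1 expr2 -{1}[x i]mulr1.
    by move/(mulfI (x0 i)).
  apply/matrixP => i j; have := MN j i.
  by rewrite !sym_mxE (inj_eq perm_inj) !x1 mulr1 expr1n mul1r.
- have /eqP := MN i0 i0; rewrite !sym_mxE !eqxx mulr0 mul1r.
  by rewrite (negPf (x0 _)).
- have /eqP := MN i0 i0; rewrite !sym_mxE !eqxx mul0r mulr1 eq_sym expf_eq0.
  by rewrite (negPf (x0 _)).
Qed.

Lemma diag_involution_rigid M (z : 'I_n -> F) :
  M \in unitmx -> mono_rel M M 1 z -> (forall i, z i ^+ 2 = 1) -> forall i,
    z i = 1.
Proof.
move=> uM [_ Mz] z2 j; have [i Mji] := unitmx_row_neq0 j uM.
by apply: (mulfI Mji); have := Mz i j; rewrite !perm1 z2 mul1r mulr1.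
Qed.

(* The permutation parts s g of the automorphisms phi g define an
   anti-homomorphism, whose kernel is free of involutions. *)
Lemma Aut_isog_dichotomy M : M \in unitmx -> Aut_isog (evolAlg M) 'S_n ->
  (rigid M /\ forall s : 'S_n, exists x, mono_rel M M s x) \/
  [/\ n = 3, exists z : 'I_n -> F,
              [/\ mono_rel M M 1 z, forall i, z i ^+ 3 = 1 & exists i, z i != 1]
    & exists (s : 'S_n) x, s != 1%g /\ mono_rel M M s x].
Proof.
move=> uM [phi [phi_inj phi_aut phiM]].
have /fin_all_exists[s /fin_all_exists[x sx]] g : exists s x,
    mono_rel M M s x /\ phi g = colhom (mono_mx s x).
  by apply/(iso_mono uM)/phi_aut; exists g.
have sx_rel g := (sx g).1; have x0 g i : x g i != 0 := (sx_rel g).1 i.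
have phiE g := (sx g).2.
have sxM g h : s (g * h)%g = (s h * s g)%g /\
               x (g * h)%g =1 (fun i => x h i * x g (s h i)).
  apply: mono_mx_inj => //; apply: colhom_inj.
  by rewrite -mono_mxM -colhomM -!phiE phiM.
have phi1 : phi 1%g = colhom 1%:M.
  have id0 (i : 'I_n) : (fun=> 1 : F) i != 0 by apply: oner_neq0.
  have /phi_aut[g phi_g] : @automorphism F (evolAlg M) (colhom 1%:M).
    rewrite -mono_mx1; apply: mono_iso; split=> // i j.
    by rewrite !perm1 mulr1 expr1n mul1r.
  rewrite -phi_g; congr phi; apply: (mulgI g); apply: phi_inj.
  by rewrite mulg1 phiM phi_g colhomM mulmx1.
have [s1 x1] : s 1%g = 1%g /\ x 1%g =1 (fun=> 1).
  by apply: mono_mx_inj => //; apply: colhom_inj; rewrite -phiE phi1 mono_mx1.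
have x_eq1 g : s g = 1%g -> (forall i, x g i = 1) -> g = 1%g.
  move=> sg xg; apply: phi_inj; rewrite phi1 phiE sg -mono_mx1; congr colhom.
  exact: eq_mono_mx.
have noinv g : s g = 1%g -> (g * g = 1)%g -> g = 1%g.
  move=> sg g2; apply: x_eq1 => //.
  have rel_g : mono_rel M M 1 (x g) by have := sx_rel g; rewrite sg.
  apply: diag_involution_rigid rel_g _ => // i.
  by have := (sxM g g).2 i; rewrite g2 x1 sg perm1 -expr2.
(* Inversion turns the anti-homomorphism [s] into a homomorphism. *)
pose psi g := (s g)^-1%g.
have psiM : {in [set: 'S_n] &, {morph psi : g h / (g * h)%g}}.
  by move=> g h _ _; rewrite /psi (sxM g h).1 invMg.
pose K := ('ker (Morphism psiM))%g.
have inK g : (g \in K) = (s g == 1%g).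
  by rewrite !inE /= /psi invg_eq1.
(* With a trivial kernel, [s] is injective, hence onto, and a diagonal automorphism, lying in the
   kernel, is the identity. *)
have [K1 | /trivgPn[g Kg g1]] := boolP (K :==: 1%g).
  have s_inj : injective s.
    move=> g h eq_s; apply/eqP; rewrite eq_mulgV1; have : (g * h^-1)%g \in K.
      by rewrite inK (sxM g _).1 eq_s -(sxM h _).1 mulgV s1.
    by rewrite (eqP K1) inE.
  left; split=> [z z0 Mz | t]; last first.
    by have /codomP[g ->] := injF_onto s_inj t; exists (x g).
  have rel_z : mono_rel M M 1 z.
    split=> // i j; rewrite !perm1; have [->|/Mz->] := eqVneq (M j i) 0.
      by rewrite mulr0 mul0r.
    exact: mulrC.
  have /phi_aut[g phi_g] := mono_iso rel_z.
  have [sg xz] : s g = 1%g /\ x g =1 z.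
    by apply: mono_mx_inj => //; apply: colhom_inj; rewrite -phiE.
  have : g \in K by rewrite inK sg.
  by rewrite (eqP K1) inE => /eqP g1 i; rewrite -xz g1.
have sg : s g = 1%g by apply/eqP; rewrite -inK.
have expS : (g ^+ n`! = 1)%g.
  by rewrite -card_Sn -cardsT expg_cardG ?inE.
(* For n < 3, n! is at most 2 and g would have square 1; for n > 3, [normal_without_involution]
   applies. *)
have n3 : n = 3.
  case: (ltngtP n 3) => // n3.
    case/negP: g1; apply/eqP/noinv => //; rewrite -expg2.
    by move: n3 expS; clear; case: n g => [|[|[|//]]] g _ // /eqP;
       rewrite ?expg1 => /eqP->; rewrite ?expg1n.
  have : K :=: 1%g.
    apply: normal_without_involution; rewrite ?card_ord ?ker_normal //.
    by move=> h; rewrite inK => /eqP; apply: noinv.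
  by move/setP/(_ g); rewrite Kg inE (negPf g1).
right; split=> //.
  exists (x g); split; first by have := sx_rel g; rewrite sg.
    (* As g^6 = 1, the kernel element g^3 has square 1. *)
    move=> i; have g3 : (g * (g * g) = 1)%g.
      apply: noinv; first by rewrite !(sxM _ _).1 sg !mulg1.
      have n6 : n`! = 6 by rewrite n3.
      by rewrite -expS n6 !expgS expg0 mulg1 !mulgA.
    have := (sxM g (g * g)%g).2 i; rewrite g3 x1 (sxM _ _).1 sg mulg1 perm1.
    by rewrite (sxM _ _).2 sg perm1 => ->; rewrite !exprS expr0 mulr1 -mulrA.
  apply/existsP; apply: contraNT g1; rewrite negb_exists => /forallP x1g.
  by apply/eqP/x_eq1 => // i; have := x1g i; rewrite negbK => /eqP.
(* A transposition is an involution, hence lies outside the kernel. *)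
have n1 : (1 < n)%N by rewrite n3.
pose t := tperm (Ordinal (ltnW n1)) (Ordinal n1).
exists (s t), (x t); split=> //; apply/eqP => /noinv;
  rewrite tperm2 => /(_ erefl).
by move/permP/(_ (Ordinal n1)); rewrite tpermR perm1.
Qed.

End Listed.

(** * The exceptional algebra of dimension 3 *)

Section Swap.
Variable F : fieldType.

Lemma ord3P (P : 'I_3 -> Prop) : P 0 -> P 1 -> P (1 + 1) -> forall i, P i.
Proof.
by move=> P0 P1 P2 [[|[|[|//]]] lti]; [move: P0 | move: P1 | move: P2];
   congr P; apply: val_inj.
Qed.

(** The three indices sum to 0 modulo 3. *)
Lemma ord3_third (a b c : 'I_3) :
  a != b -> (c == - (a + b)) = (c != a) && (c != b).
Proof. by move: a b c; do 3! elim/ord3P. Qed.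

Definition swap_mx : 'M[F]_3 :=
  seqs_mx 3 [:: [:: 0; 1; 0]; [:: 1; 0; 0]; [:: 0; 0; 1]].

Definition cube_roots3 : Prop :=
  exists x y z : F, uniq [:: x; y; z] /\ all (root ('X^3 - 1)) [:: x; y; z].

Lemma root_X3sub1 (x : F) : root ('X^3 - 1) x = (x ^+ 3 == 1).
Proof. by rewrite rootE !hornerE subr_eq0. Qed.

(** A cubic has at most three roots, so the three given ones are all. *)
Lemma cube_roots3P : cube_roots3 -> exists r : 'I_3 -> F,
  injective r /\ forall z, z ^+ 3 = 1 <-> exists k, r k = z.
Proof.
move=> [x [y [z [xyz /allP rt]]]]; exists (fun k : 'I_3 => [:: x; y; z]`_k).
split=> [k l /eqP | t].
  by rewrite nth_uniq //; move/eqP/val_inj.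
split=> [t3 | [k <-]]; last by apply/eqP; rewrite -root_X3sub1 rt ?mem_nth.
have : t \in [:: x; y; z].
  apply: contraT => t_xyz.
  have := @max_poly_roots _ ('X^3 - 1) (t :: [:: x; y; z]).
  rewrite -size_poly_eq0 size_XnsubC // [uniq _]cons_uniq t_xyz xyz /=.
  rewrite root_X3sub1 t3 eqxx !rt ?inE ?eqxx ?orbT // => /(_ isT isT isT).
  by rewrite ltnn.
by move/(nthP 0)=> [k lt_k <-]; exists (Ordinal lt_k).
Qed.

Lemma sum_ord3 (f : 'I_3 -> F) : \sum_i f i = f 0 + f 1 + f (1 + 1).
Proof.
rewrite !big_ord_recl big_ord0 addr0 addrA.
by congr (f _ + f _ + f _); apply: val_inj.
Qed.

Lemma swap_mx_unit : swap_mx \in unitmx.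
Proof.
case: (@mulmx1_unit _ _ swap_mx swap_mx) => //; apply/matrixP.
do 2! elim/ord3P; rewrite !mxE sum_ord3 !mxE /=; ring.
Qed.

Lemma morph_on_span (A B : comAlgebra F) n (w : 'I_n -> A) (f : 'Hom(A, B)) :
    (forall u, exists c : 'I_n -> F, u = \sum_k c k *: w k) ->
    (forall k l, f (amul A (w k) (w l)) = amul B (f (w k)) (f (w l))) ->
  {morph f : u v / amul A u v >-> amul B u v}.
Proof.
move=> span_w fM u v; have [c ->] := span_w u; have [d ->] := span_w v.
rewrite linear_sumlz linear_sum [f (\sum_k c k *: _)]linear_sum linear_sumlz;
  apply: eq_bigr => k _.
rewrite linearZl_LR !linearZ linearZl_LR /=; congr (_ *: _).
rewrite linear_sumr linear_sum linear_sum linear_sumr; apply: eq_bigr => l _.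
by rewrite !linearZ /= fM.
Qed.

Section SwapAut.
Variable r : 'I_3 -> F.
Hypotheses (r_inj : injective r)
  (rP : forall z, z ^+ 3 = 1 <-> exists k, r k = z).

Let r3 k : r k ^+ 3 = 1. Proof. by apply/rP; exists k. Qed.

Let cube_id (z : F) : z ^+ 3 = 1 -> z ^+ 4 = z.
Proof. by move=> z3; rewrite exprSr z3 mul1r. Qed.

Let cube_neq0 (z : F) : z ^+ 3 = 1 -> z != 0.
Proof.
by apply: contra_eqN => /eqP->; rewrite expr0n eq_sym oner_neq0.
Qed.

(** For distinct k and l, the left side is a cube root of unity other than [r k] and [r l], hence
    the third one. *)
Lemma cube_rootsM k l : (r k * r l) ^+ 2 = r (- (k + l)).
Proof.
have [->|kl] := eqVneq k l.
  have -> : - (l + l) = l by move: l; elim/ord3P; apply: val_inj.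
  by rewrite -[RHS]cube_id ?r3 //; ring.
have sq_inj (z t : F) : z ^+ 3 = 1 -> t ^+ 3 = 1 -> (z * t) ^+ 2 = z -> z = t.
  move=> z3 t3 eq_z; have tz : t ^+ 2 = z ^+ 2.
    have z0 := cube_neq0 z3.
    have zt : z * t ^+ 2 = 1 by apply: (mulfI z0); rewrite mulr1 -[RHS]eq_z;
      ring.
    by rewrite -[LHS]mulr1 -z3 -[RHS]mul1r -zt; ring.
  by rewrite -(cube_id z3) -(cube_id t3) -[4%N]/(2 * 2)%N !exprM tz.
have [m rm] : exists m, r m = (r k * r l) ^+ 2.
  by apply/rP; rewrite exprAC [(_ * _) ^+ 3]exprMn !r3 mulr1 expr1n.
rewrite -rm; congr r; apply/eqP; rewrite ord3_third //; apply/andP; split.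
  by apply: contraNneq kl => mk; apply/eqP/r_inj/sq_inj; rewrite -?rm ?mk.
apply: contraNneq kl => ml; apply/eqP/esym/r_inj/sq_inj => //.
by rewrite mulrC -rm ml.
Qed.

(* The columns (r k, r k ^ 2, 1) are the idempotents without zero coordinate. *)
Definition root_mx : 'M[F]_3 := \matrix_(a, k) r k ^+ (a + 1 : 'I_3)%R.

(** A cyclic shift of the rows gives a Vandermonde matrix with distinct nodes. *)
Lemma root_mx_unit : root_mx \in unitmx.
Proof.
have -> : root_mx = row_perm (perm (addIr (1 :
  'I_3))) (Vandermonde 3 (\row_k r k)).
  by apply/matrixP => a k; rewrite !mxE permE.
rewrite row_permE unitmx_mul unitmx_perm unitmxE det_Vandermonde unitfE.
apply/prodf_neq0 => i _; apply/prodf_neq0 => j ij; rewrite !mxE subr_eq0.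
by rewrite (inj_eq r_inj) neq_ltn ij orbT.
Qed.

Local Notation "u *s v" := (amul (evolAlg swap_mx) u v) (at level 40).

Lemma swap_mulE (u v : 'cV[F]_3) :
  [/\ (u *s v) 0 0 = u 1 0 * v 1 0, (u *s v) 1 0 = u 0 0 * v 0 0
    & (u *s v) (1 + 1) 0 = u (1 + 1) 0 * v (1 + 1) 0].
Proof. by split; rewrite evol_mulE sum_ord3 !mxE /=; ring. Qed.

Lemma root_mx_mul k l :
  col k root_mx *s col l root_mx = col (- (k + l)) root_mx.
Proof.
have [e0 e1 e2] := swap_mulE (col k root_mx) (col l root_mx).
apply/colP; elim/ord3P; rewrite ?e0 ?e1 ?e2 !mxE /= -cube_rootsM.
- by rewrite expr1 exprMn.
- by rewrite -exprM exprMn !cube_id.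
- by rewrite mulr1.
Qed.

Lemma swap_idempotent (u : 'cV[F]_3) :
  u *s u = u -> (forall i, u i 0 != 0) -> exists k, u = col k root_mx.
Proof.
have [e0 e1 e2] := swap_mulE u u; move=> uu u0; rewrite uu in e0 e1 e2.
have [k rk] : exists k, r k = u 0 0.
  apply/rP; apply: (mulfI (u0 0)); rewrite mulr1 -exprS {2}e0 e1; ring.
have u2 : u (1 + 1) 0 = 1 by apply: (mulfI (u0 (1 + 1))); rewrite mulr1 -e2.
exists k; apply/colP; elim/ord3P; rewrite !mxE /= ?rk ?u2 ?e1 ?expr1 ?expr2 //.
Qed.

Definition swap_aut (g : 'S_3) : 'M[F]_3 :=
  root_mx *m mono_mx g^-1 (fun=> 1) *m invmx root_mx.

Lemma swap_aut_col g k : swap_aut g *m col k root_mx = col (g^-1%g k) root_mx.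
Proof.
rewrite !colE !mulmxA mulmxKV ?root_mx_unit // -mulmxA; congr (_ *m _).
apply/colP => a; rewrite -[in LHS](permKV g^-1 a) mono_mx_act !mxE mul1r.
by rewrite -[in RHS](permKV g^-1 a) (inj_eq perm_inj).
Qed.

(** The operation [- (k + l)] returns k if k = l and the third index otherwise, a description that
    every permutation respects. *)
Lemma third_perm (s : 'S_3) k l : s (- (k + l)) = - (s k + s l).
Proof.
have [->|kl] := eqVneq k l.
  have dbl m : - (m + m) = m :> 'I_3 by move: m; elim/ord3P; apply: val_inj.
  by rewrite !dbl.
apply/eqP; rewrite ord3_third ?(inj_eq perm_inj) //.
by rewrite -ord3_third.
Qed.

Lemma swap_aut_iso g : @automorphism F (evolAlg swap_mx) (colhom (swap_aut g)).
Proof.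
split.
  apply: colhom_bij; rewrite !unitmx_mul unitmx_inv root_mx_unit mono_mx_unit
    //.
  by move=> i; apply: oner_neq0.
have expand (u : evolAlg swap_mx) : exists c :
  'I_3 -> F, u = \sum_k c k *: col k root_mx.
  exists (fun k => (invmx root_mx *m u) k 0).
  rewrite -{1}[u](mulKVmx root_mx_unit) {1}[_ *m u]col_sum_delta mulmx_sumr.
  by apply: eq_bigr => k _; rewrite -scalemxAr colE.
apply: (morph_on_span expand) => k l.
by rewrite root_mx_mul !colhomE !swap_aut_col root_mx_mul third_perm.
Qed.

(** A monomial automorphism permutes the idempotents without zero coordinate. These form a basis, so
    their permutation determines the automorphism. *)
Lemma swap_Aut_isog : Aut_isog (evolAlg swap_mx) 'S_3.
Proof.
have uV := root_mx_unit; have uVi :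
  invmx root_mx \in unitmx by rewrite unitmx_inv.
exists (fun g => colhom (swap_aut g)); split.
- move=> g h /colhom_inj/(can_inj (mulmxK uVi))/(can_inj (mulKmx uV)).
  have one0 (i : 'I_3) : (fun=> 1 : F) i != 0 by apply: oner_neq0.
  by move=> /(mono_mx_inj one0)[/invg_inj].
- move=> f; split=> [aut_f | [g <-]]; last exact: swap_aut_iso.
  have [_ fM] := aut_f; have [s [x [[x0 _] def_f]]] := iso_mono swap_mx_unit
    aut_f.
  have /fin_all_exists[t ft] k : exists l, f (col k root_mx) = col l root_mx.
    apply: swap_idempotent => [|i].
      rewrite -fM root_mx_mul; congr (f (col _ _)).
      by move: k; elim/ord3P; apply: val_inj.
    rewrite def_f colhomE -(permKV s i) mono_mx_act mulf_neq0 // !mxE.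
    by apply/expf_neq0/cube_neq0.
  have t_inj : injective t.
    move=> k l eq_t; have := ft k; rewrite eq_t -ft => /(bij_inj aut_f.1).
    rewrite !colE => /(can_inj (mulKmx uV))/colP/(_ k);
      rewrite !mxE !eqxx andbT.
    by case: eqP => // _ /eqP; rewrite oner_eq0.
  exists (perm t_inj)^-1%g; rewrite def_f; congr colhom.
  apply: (can_inj (mulmxK uV)); apply: mulmx_col_inj => v.
  rewrite [v]col_sum_delta !mulmx_sumr; apply: eq_bigr => k _.
  rewrite -!scalemxAr -!(mulmxA _ root_mx) -!colE swap_aut_col invgK permE -ft
    def_f.
  by rewrite colhomE.
- move=> g h; rewrite colhomM; congr colhom.
  rewrite /swap_aut !mulmxA mulmxKV // -(mulmxA root_mx (mono_mx g^-1 _))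
    mono_mxM invMg.
  by do 2! congr (_ *m _); apply: eq_mono_mx => i; rewrite mulr1.
Qed.

End SwapAut.

Lemma swap_Sn : cube_roots3 -> Sn_evolution_algebra 3 (evolAlg swap_mx).
Proof.
case/cube_roots3P => r [r_inj rP]; split.
- by exists (std_basis swap_mx); apply: std_basis_natural.
- exact/evolAlg_idempotent/swap_mx_unit.
- exact: swap_Aut_isog r_inj rP.
Qed.

End Swap.

(** * The case of a nontrivial diagonal automorphism *)

Section SwapClassification.
Variable F : fieldType.

(** Some term in the expansion of the determinant is nonzero. *)
Lemma unitmx_perm_neq0 n (M : 'M[F]_n) :
  M \in unitmx -> exists s : 'S_n, forall i, M (s i) i != 0.
Proof.
rewrite -unitmx_tr => uM.
case: (pickP (fun s : 'S_n => [forall i, M (s i) i != 0])) => [s /forallP|none].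
  by exists s.
move: uM; rewrite unitmxE unitfE /determinant big1 ?eqxx // => s _.
have /negbT := none s; rewrite negb_forall => /existsP[i].
by rewrite negbK => /eqP Mi; rewrite (bigD1 i) //= mxE Mi mul0r mulr0.
Qed.

(** A nonzero M_ba forces z_b = z_a^2. Squaring swaps the two nontrivial cube roots and fixes 1,
    which leaves three entries of [M] that can be nonzero. *)
Lemma swap_classification (M : 'M[F]_3) (z : 'I_3 -> F) :
    M \in unitmx -> mono_rel M M 1 z -> (forall i, z i ^+ 3 = 1) ->
    (exists i, z i != 1) ->
    (exists (s : 'S_3) x, s != 1%g /\ mono_rel M M s x) ->
  cube_roots3 F /\ isomorphic (evolAlg M) (evolAlg (swap_mx F)).
Proof.
move=> uM [z0 Mz] z3 [i zi1] [s [x [s1 relx]]]; have [x0 Mx] := relx.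
have zM a b : M b a != 0 -> z b = z a ^+ 2.
  by move=> Mba; apply: (mulfI Mba); have := Mz a b;
    rewrite !perm1 mulrC => ->; rewrite mulrC.
have [p Mp] := unitmx_perm_neq0 uM; have zp a := zM _ _ (Mp a).
have z4 a : z a ^+ 4 = z a by rewrite exprSr z3 mul1r.
have sq1 a : z a = z a ^+ 2 -> z a = 1.
  by move=> za; apply: (mulfI (z0 a)); rewrite mulr1 -expr2 -za.
have ji : i != p i by apply: contraNneq zi1 => eq_i;
  rewrite {1}sq1 // {1}eq_i zp.
set j := p i in ji.
have [t [t0 t1]] : exists t : 'S_3,
  t 0 = i /\ t 1 = j by apply: perm_2transitive.
set k := t (1 + 1).
have ijk l : [\/ l = i, l = j | l = k].
  rewrite -(permKV t l); move: (t^-1%g l); elim/ord3P; rewrite ?t0 ?t1.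
  - exact: Or31.
  - exact: Or32.
  - exact: Or33.
have ki : k != i by rewrite -t0 (inj_eq perm_inj).
have kj : k != j by rewrite -t1 (inj_eq perm_inj).
have zj : z j = z i ^+ 2 := zp i.
have pj : p j = i.
  case: (ijk (p j)) => // [pj | pj].
    by have := perm_inj pj => eq_ji; rewrite eq_ji eqxx in ji.
  (* Here p would be a 3-cycle, and z_i = z_i^8 = z_i^2. *)
  have pk : p k = i.
    case: (ijk (p k)) => // [pk | pk].
      by rewrite (perm_inj pk) eqxx in ki.
    by rewrite -[in RHS]pj in pk; rewrite (perm_inj pk) eqxx in kj.
  case/eqP: zi1; apply: sq1; have := zp k; have := zp j; rewrite pj pk.
  by move=> -> zi; rewrite {1}zi zj -[z i ^+ 2 ^+ 2]exprM z4.
have pk : p k = k.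
  case: (ijk (p k)) => // pk.
    by rewrite -[in RHS]pj in pk; rewrite (perm_inj pk) eqxx in kj.
  by rewrite (perm_inj pk) eqxx in ki.
have zk : z k = 1 by apply: sq1; have := zp k; rewrite pk.
have Mji : M j i != 0 := Mp i.
have Mij : M i j != 0 by rewrite -{1}pj.
have Mkk : M k k != 0 by rewrite -{1}pk.
have zi2 : z i ^+ 2 != 1.
  by apply: contraNneq zi1 => zi2; have := z3 i; rewrite exprSr zi2 mul1r => ->.
have zii : z i ^+ 2 != z i by apply: contraNneq zi1 => zi; apply/eqP/sq1.
have M0 a b : z b != z a ^+ 2 -> M b a = 0.
  by move=> zb; apply: contraNeq zb => /zM->.
have Mii : M i i = 0 by apply: M0; rewrite eq_sym.
have Mki : M k i = 0 by apply: M0; rewrite zk eq_sym.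
have zj2 : z j ^+ 2 = z i by rewrite zj -exprM z4.
have Mjj : M j j = 0 by apply: M0; rewrite zj2 zj.
have Mkj : M k j = 0 by apply: M0; rewrite zj2 zk eq_sym.
have Mik : M i k = 0 by apply: M0; rewrite zk expr1n.
have Mjk : M j k = 0 by apply: M0; rewrite zk expr1n zj.
split.
  exists 1, (z i), (z i ^+ 2); rewrite /= !root_X3sub1 !inE expr1n z3 exprAC z3.
  by rewrite expr1n !eqxx negb_or ![1 == _]eq_sym ![z i == _ ^+ _]eq_sym zi1
    zi2 zii.
(* Only k has a nonzero diagonal entry, so s fixes k; being nontrivial, s swaps i and j. *)
have sk : s k = k.
  have := mono_rel_neq0 k k relx; rewrite (negPf Mkk).
  by case: (ijk (s k)) => ->; rewrite ?Mii ?Mjj ?eqxx.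
have [si sj] : s i = j /\ s j = i.
  have si_k : s i != k by rewrite -{1}sk (inj_eq perm_inj) eq_sym.
  have sj_k : s j != k by rewrite -{1}sk (inj_eq perm_inj) eq_sym.
  have [si|si|si] := ijk (s i); last by rewrite si eqxx in si_k.
    have [sj|sj|sj] := ijk (s j); last by rewrite sj eqxx in sj_k.
      by case/eqP: ji; apply: (@perm_inj _ s); rewrite si sj.
    by case/eqP: s1; apply/permP => l; rewrite perm1; case: (ijk l) => ->.
  have [sj|sj|sj] := ijk (s j) => //; last by rewrite sj eqxx in sj_k.
  by case/eqP: ji; apply: (@perm_inj _ s); rewrite si sj.
have xj : M j i * x j = x i ^+ 2 * M i j by rewrite Mx si sj.
have xi : M i j * x i = x j ^+ 2 * M j i by rewrite Mx si sj.
(* The quotient M_ji / M_ij is thus a cube, which allows both entries to be scaled to 1 inside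
   [F]. *)
have eqMji : M j i = x i ^+ 3 * M i j.
  have {}xj : x j = x i ^+ 2 * M i j / M j i by rewrite -xj mulrC mulKf.
  apply: (mulfI Mij); apply: (mulfI (x0 i)); apply: (mulIf (invr_neq0 Mji)).
  rewrite mulrA [x i * _]mulrC xi xj; field; rewrite Mji //.
apply: isomorphic_sym; pose y (a : 'I_3) := [:: (M i j * x i ^+ 2)^-1;
  (M i j * x i)^-1; (M k k)^-1]`_a.
apply: (@mono_rel_isomorphic _ _ _ _ t y); split.
  by elim/ord3P; rewrite /y /= invr_neq0 ?mulf_neq0 ?expf_neq0.
by elim/ord3P; elim/ord3P; rewrite ?t0 ?t1 -?/k ?Mii ?Mjj ?Mik ?Mjk ?Mki ?Mkj
   !mxE /y /= ?eqMji ?mul0r ?mulr0 //; field; rewrite ?Mkk ?Mij ?x0.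
Qed.

(** Isomorphisms preserve the vanishing of diagonal entries; [swap_mx] has diagonal entries of both
    kinds, while a symmetric form has a constant diagonal. *)
Lemma sym_swap_nisomorphic (M : 'M[F]_3) :
  sym_listed M -> ~ isomorphic (evolAlg (swap_mx F)) (evolAlg M).
Proof.
move=> listM [f /(iso_mono _)[]]; first by case: listM.
move=> s [x [relx _]]; have [a [b defM]] := sym_listedE listM.
have := mono_rel_neq0 0 0 relx; have := mono_rel_neq0 (1 + 1) (1 + 1) relx.
rewrite defM !sym_mxE !eqxx !mxE /= eqxx oner_eq0 => ->; done.
Qed.

End SwapClassification.

(** * Complete lists in terms of normal forms; invertibility and rigidity *)

Section Lists.
Variable F : fieldType.

Lemma complete_list_ext n (L L' : 'M[F]_n -> Prop) :
  (forall M, L M <-> L' M) -> complete_list F n L -> complete_list F n L'.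
Proof.
move=> eqL [L_Sn L_uniq L_ex]; split=> [M /eqL/L_Sn | M N /eqL LM /eqL LN | A
  /L_ex[M /eqL]] //.
  exact: L_uniq.
by exists M.
Qed.

Lemma Sn_algebra_dichotomy n (A : comAlgebra F) : Sn_evolution_algebra n.+1 A ->
  (exists2 M : 'M[F]_n.+1, sym_listed M & isomorphic A (evolAlg M)) \/
  exists e : n.+1 = 3, cube_roots3 F /\ isomorphic A (evolAlg (swap_mx F)).
Proof.
case=> /evolution_algebraE[M isoAM] idA autA.
have uM : M \in unitmx by apply/evolAlg_idempotent/(isomorphic_idempotent
  isoAM).
have [[rM symM] | [n3 [z [relz z3 z1]] symM]] :=
  Aut_isog_dichotomy uM (isomorphic_Aut_isog isoAM autA).
  have [N listN isoMN] := symmetric_sym_listed uM rM symM.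
  by left; exists N => //; apply: isomorphic_trans isoMN.
right; exists n3; case: n3 => n2; subst n.
have [r3 isoM] := swap_classification uM relz z3 z1 symM.
by split=> //; apply: isomorphic_trans isoM.
Qed.

Lemma sym_complete_list n : (0 < n)%N -> n != 3 ->
  complete_list F n (@sym_listed F n).
Proof.
move=> n0 n3; split=> [M | M N listM listN | A].
- exact: sym_listed_Sn.
- exact: sym_listed_uniq.
- case: n n0 n3 => // n _ /eqP n3.
  by case/Sn_algebra_dichotomy => // -[e]; case: n3.
Qed.

Lemma sym_complete_list3 : complete_list F 3
  (fun M => sym_listed M \/ cube_roots3 F /\ M = swap_mx F).
Proof.
split=> [M [|[r3 ->]] | M N | A /Sn_algebra_dichotomy[[M listM isoM]|[_ [r3
  isoA]]]].
- exact: sym_listed_Sn.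
- exact: swap_Sn.
- move=> [listM|[_ ->]] [listN|[_ ->]] isoMN //.
  + exact: sym_listed_uniq isoMN.
  + by case: (sym_swap_nisomorphic listM); apply: isomorphic_sym.
  + by case: (sym_swap_nisomorphic listN).
- by exists M => //; left.
- by exists (swap_mx F) => //; right.
Qed.

(** The matrix is (a - b) I + b J with J all ones and J^2 = n J; the two factors are its
    eigenvalues. *)
Lemma sym_mx_unitE n (a b : F) : (1 < n)%N ->
  (sym_mx n a b \in unitmx) = (a != b) && (a + n.-1%:R * b != 0).
Proof.
move=> n1; pose J : 'M[F]_n := const_mx 1.
have symE c d : sym_mx n c d = (c - d)%:M + d *: J.
  apply/matrixP => i j; rewrite sym_mxE !mxE mulr1.
  by case: eqP; rewrite ?mulr1n ?subrK ?mulr0n ?add0r.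
have JJ : J *m J = n%:R *: J.
  apply/matrixP => i j; rewrite !mxE mulr1; under eq_bigr do rewrite !mxE mulr1.
  by rewrite sumr_const card_ord.
have n1E : n%:R = n.-1%:R + 1 :> F by rewrite natr1 prednK // ltnW.
have mulE c d : sym_mx n a b *m ((c - d)%:M + d *: J)
    = ((a - b) * (c - d))%:M + ((a - b) * d + b * (c - d) + b * d * n%:R) *: J.
  rewrite symE mulmxDl !mulmxDr -scalar_mxM !mul_scalar_mx mul_mx_scalar.
  rewrite -!scalemxAl -!scalemxAr JJ !scalerA -addrA -!scalerDl.
  by rewrite addrA [(c - d) * b]mulrC.
pose i0 := Ordinal (ltnW n1); pose i1 := Ordinal n1.
apply/idP/andP => [uM | [ab s0]]; last first.
  have d0 : a - b != 0 by rewrite subr_eq0.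
  (* The inverse is sought as (a - b)^-1 I + d J, and d makes the coefficient of J in the product
     vanish. *)
  pose d := - b / ((a - b) * (a + n.-1%:R * b)).
  case: (@mulmx1_unit _ _ (sym_mx n a b) (((a - b)^-1 + d - d)%:M + d *: J))
    => //.
  rewrite mulE addrK divff // [X in X *: J](_ : _ = 0) ?scale0r ?addr0 //.
  by rewrite n1E /d; field; rewrite s0 d0.
(* If either factor vanishes, the matrix annihilates a nonzero matrix: J - n I, respectively J. *)
split; apply/eqP => ab0.
  have /matrixP/(_ i0 i1)/eqP : J - n%:R%:M = 0.
    rewrite -[LHS](mulKmx uM) [X in _ *m X](_ : _ = 0) ?mulmx0 //.
    rewrite symE ab0 subrr raddf0 add0r -scalemxAl mulmxBr JJ mul_mx_scalar.
    by rewrite subrr scaler0.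
  by rewrite !mxE subr0 oner_eq0.
have /matrixP/(_ i0 i0)/eqP : J = 0.
  rewrite -[LHS](mulKmx uM) [X in _ *m X](_ : _ = 0) ?mulmx0 //.
  rewrite symE mulmxDl mul_scalar_mx -scalemxAl JJ scalerA -scalerDl.
  have -> : a - b + b * n%:R = a + n.-1%:R * b by rewrite n1E; ring.
  by rewrite ab0 scale0r.
by rewrite !mxE oner_eq0.
Qed.

Lemma rigid_sym_mx1 n c : rigid (sym_mx n 1 c : 'M[F]_n).
Proof.
move=> x x0 Mx i; apply: (mulfI (x0 i)).
by rewrite mulr1 -expr2 -(Mx i i) // sym_mxE eqxx oner_neq0.
Qed.

(** For any i and j, an index k different from both gives x_i = x_k^2 = x_j, so x is constant and
    equal to its square. *)
Lemma rigid_sym_mx01 n : (2 < n)%N -> rigid (sym_mx n 0 1 : 'M[F]_n).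
Proof.
move=> n2 x x0 Mx.
have xE i j : i != j -> x j = x i ^+ 2.
  by move=> ij; apply: Mx; rewrite sym_mxE [j == i]eq_sym (negPf ij) oner_neq0.
have other (i j : 'I_n) : exists k, (k != i) && (k != j).
  have : (0 < #|[predC [:: i; j]]|)%N.
    rewrite -(ltn_add2l #|[:: i; j]|) cardC addn0 card_ord.
    by rewrite (leq_ltn_trans (card_size _)).
  by case/card_gt0P => k; rewrite !inE negb_or => ?; exists k.
have const i j : x i = x j.
  by have [k /andP[ki kj]] := other i j; rewrite (xE k i) // (xE k j).
move=> i; have [k /andP[ki _]] := other i i.
by apply: (mulfI (x0 i)); rewrite mulr1 -expr2 -(xE i k) 1?eq_sym // (const k
  i).
Qed.

(** The solutions without zeros of y_1 = y_0^2 and y_0 = y_1^2 are the pairs (w, w^2) with w^3 =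
    1. *)
Lemma rigid_sym_mx01_2 :
  rigid (sym_mx 2 0 1 : 'M[F]_2) <-> exists! x : F, root ('X^3 - 1) x.
Proof.
split=> [rM | [x [_ x_uniq]] y y0 My].
  exists 1; split=> [|x]; rewrite root_X3sub1 ?expr1n // => /eqP x3.
  have x0 : x != 0 by apply: contra_eqN x3 => /eqP->;
    rewrite expr0n eq_sym oner_neq0.
  apply/esym/(rM (fun i => if i == 0 then x else x ^+ 2) _ _ 0).
    by move=> i; case: ifP; rewrite ?expf_neq0.
  move=> i j; rewrite sym_mxE; case: (eqVneq j i) => [->|ji _];
    first by rewrite eqxx.
  have [i0 | i0] := eqVneq i 0; first by rewrite i0 in ji; rewrite (negPf ji).
  have -> : j == 0 by move: i j i0 ji; do 2! case=> [[|[|//]] ?].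
  by rewrite -exprM (exprD x 3 1) x3 mul1r.
have y01 : y 1 = y 0 ^+ 2 by apply: My; rewrite sym_mxE oner_neq0.
have y10 : y 0 = y 1 ^+ 2 by apply: My; rewrite sym_mxE oner_neq0.
have root1 : root ('X^3 - 1) (1 : F) by rewrite root_X3sub1 expr1n.
have y0_1 : y 0 = 1.
  rewrite -(x_uniq _ root1); apply/esym/x_uniq; rewrite root_X3sub1; apply/eqP.
  by apply: (mulfI (y0 0)); rewrite mulr1 -exprS {2}y10 y01 -exprM.
by case=> [[|[|//]] lti]; [rewrite -y0_1 | rewrite -[RHS](expr1n _ 2) -y0_1
  -y01];
   congr y; apply: val_inj.
Qed.

End Lists.

(** * Explicit matrices and conditions on the parameters *)

Section Matrices.
Variable F : fieldType.

Lemma seqs_mx1E : seqs_mx 1 [:: [:: 1 : F]] = sym_mx 1 1 0.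
Proof. by apply/matrixP => i j; rewrite sym_mxE !mxE !ord1. Qed.

Lemma seqs_mx2E (a b : F) : seqs_mx 2 [:: [:: a; b]; [:: b; a]] = sym_mx 2 a b.
Proof.
by apply/matrixP; do 2! case=> [[|[|//]] ?]; rewrite sym_mxE !mxE.
Qed.

Lemma seqs_mx3E (a b : F) :
  seqs_mx 3 [:: [:: a; b; b]; [:: b; a; b]; [:: b; b; a]] = sym_mx 3 a b.
Proof. by apply/matrixP; do 2! elim/ord3P; rewrite sym_mxE !mxE. Qed.

Lemma sym_listed1 (M : 'M[F]_1) : sym_listed M <-> M = seqs_mx 1 [:: [:: 1]].
Proof.
rewrite seqs_mx1E; split=> [[uM _ [[c ->]|defM]] | ->].
- by apply/matrixP => i j; rewrite !sym_mxE !ord1.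
(* For n = 1 the matrix K_1 is zero. *)
- by have [i] := unitmx_row_neq0 0 uM; rewrite defM sym_mxE !ord1 !eqxx.
- split; [| exact: rigid_sym_mx1 | by left; exists 0].
  by rewrite /sym_mx scale0r addr0 unitmx1.
Qed.

Lemma sym_listedP n (M : 'M[F]_n) : (1 < n)%N -> sym_listed M <->
  (exists2 c, c != 1 /\ 1 + n.-1%:R * c != 0 & M = sym_mx n 1 c) \/
  [/\ n.-1%:R != 0 :> F, rigid (sym_mx n 0 1 : 'M[F]_n) & M = sym_mx n 0 1].
Proof.
move=> n1; split=> [[uM rM [[c defM]|defM]] | [[c [c1 cn] ->] | [n0 rM ->]]].
- move: uM; rewrite defM sym_mx_unitE // eq_sym => /andP[c1 cn].
  by left; exists c.
- move: uM; rewrite defM sym_mx_unitE // add0r mulr1 => /andP[_ n0].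
  by right; split; rewrite // -defM.
- split; [| exact: rigid_sym_mx1 | by left; exists c].
  by rewrite sym_mx_unitE // eq_sym c1.
- split=> //; last by right.
  by rewrite sym_mx_unitE // add0r mulr1 n0 eq_sym oner_neq0.
Qed.

Lemma pchar2E : (2%N \notin [pchar F]) = (2%:R != 0 :> F).
Proof. by rewrite inE. Qed.

End Matrices.

Theorem theorem3p2 (F : fieldType) :
  [/\ complete_list F 1 (fun M => M = seqs_mx 1 [:: [:: 1]]),
      complete_list F 2 (fun M =>
           (exists2 c : F, c ^+ 2 != 1
              & M = seqs_mx 2 [:: [:: 1; c];
                                  [:: c; 1]])
        \/ (exists! x : F, root ('X^3 - 1) x)
             /\ M = seqs_mx 2 [:: [:: 0; 1];
                                  [:: 1; 0]]),
      complete_list F 3 (fun M =>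
        [\/ exists2 c : F,
              c != 1 /\ (2%N \notin [pchar F] -> c != - 1 / 2%:R)
              & M = seqs_mx 3 [:: [:: 1; c; c];
                                  [:: c; 1; c];
                                  [:: c; c; 1]],
            (exists x y z : F,
               uniq [:: x; y; z] /\ all (root ('X^3 - 1)) [:: x; y; z])
             /\ M = seqs_mx 3 [:: [:: 0; 1; 0];
                                  [:: 1; 0; 0];
                                  [:: 0; 0; 1]]
          | 2%N \notin [pchar F]
             /\ M = seqs_mx 3 [:: [:: 0; 1; 1];
                                  [:: 1; 0; 1];
                                  [:: 1; 1; 0]]])
    & forall n : nat, (4 <= n)%N ->
      complete_list F n (fun M =>
           (exists2 c : F,
              c != 1 /\ ((n - 1)%:R != 0 :> F -> c != 1 / (1 - n%:R))
              & M = 1%:M + c *: offdiag_mx F n)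
        \/ (n - 1)%:R != 0 :> F /\ M = offdiag_mx F n)].
Proof.
(* When m = 0 in F, the division makes no sense and 1 + m c = 1. *)
have unit_cond (m c d : F) : (m != 0 -> m * d = -1) ->
    1 + m * c != 0 <-> (m != 0 -> c != d).
  have [-> _ | m0 /(_ isT) md] := eqVneq m 0.
    by rewrite mul0r addr0 oner_neq0.
  have -> : (1 + m * c != 0) = (c != d).
    by rewrite -[c == d](inj_eq (mulfI m0)) md -addr_eq0 addrC.
  by split=> // /(_ isT).
split.
- apply: complete_list_ext (sym_complete_list F _ _) => // M.
  exact: sym_listed1.
- apply: complete_list_ext (sym_complete_list F _ _) => // M.
  (* For n = 2, the conditions c != 1 and 1 + c != 0 combine to c^2 != 1. *)
  rewrite sym_listedP // seqs_mx2E;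
    split=> [[[c [c1 c2] ->]|[_ rM ->]] | [[c c1 ->]|[x_uniq ->]]].
  + left; exists c; rewrite ?seqs_mx2E //.
    by rewrite sqrf_eq1 negb_or c1 -addr_eq0 addrC -[c]mul1r.
  + by right; split=> //; apply/rigid_sym_mx01_2.
  + left; exists c; rewrite ?seqs_mx2E //; move: c1.
    by rewrite sqrf_eq1 negb_or -addr_eq0 addrC mul1r => /andP[].
  + right; split; rewrite // ?oner_neq0 //; exact/rigid_sym_mx01_2.
- apply: complete_list_ext (sym_complete_list3 F) => M.
  have cond (c : F) : 1 + 2%:R * c != 0 <-> (2%N \notin [pchar F] ->
    c != - 1 / 2%:R).
    by rewrite pchar2E; apply: unit_cond => n2; rewrite mulrC divfK.
  split=> [[/(sym_listedP (n := 3) _ isT)[[c [c1 /cond c2] ->]|[n2 _ ->]] |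
    [r3 ->]]|
           [[c [c1 /cond c2] ->]|[r3 ->]|[n2 ->]]].
  + by apply: Or31; exists c; rewrite ?seqs_mx3E.
  + by apply: Or33; rewrite seqs_mx3E pchar2E.
  + exact: Or32.
  + by left; apply/sym_listedP => //; left; exists c; rewrite ?seqs_mx3E.
  + by right.
  + left; apply/sym_listedP => //; right; rewrite seqs_mx3E -pchar2E;
    split=> //.
    exact: rigid_sym_mx01.
- move=> n n4; have n1 : (1 < n)%N by apply: leq_trans n4.
  have n3 : n != 3 by rewrite eqn_leq [(n <= 3)%N]leqNgt n4.
  apply: complete_list_ext (sym_complete_list F (ltnW n1) n3) => M.
  have cond (c : F) : 1 + n.-1%:R * c != 0 <-> ((n - 1)%:R != 0 :> F ->
    c != 1 / (1 - n%:R)).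
    rewrite subn1; apply: unit_cond => m0.
    have -> : 1 - n%:R = - n.-1%:R :> F.
      by rewrite -{1}[n]prednK 1?ltnW // -natr1; ring.
    by rewrite mul1r invrN mulrN divff.
  rewrite sym_listedP //; split=> [[[c [c1 /cond c2] ->]|[n0 _ ->]] | [[c [c1
    /cond c2] ->]|[n0 ->]]].
  + by left; exists c.
  + by right; rewrite subn1 /sym_mx raddf0 add0r scale1r.
  + by left; exists c.
  + right; split; [by rewrite -subn1 | exact: rigid_sym_mx01 (ltnW n4) |].
    by rewrite /sym_mx raddf0 add0r scale1r.
Qed.
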